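(* Let $\mathbb K$ be an algebraically closed field of characteristic zero, and let $V$ and $W$ be $\mathbb K[x,y]$-modules that are finite dimensional over $\mathbb K$. If $V$ and $W$ are weakly isomorphic, then the corresponding associated Lie algebras $L_V$ and $L_W$ are isomorphic.
   Context: Associated Lie algebra: for a $\mathbb K[x,y]$-module $V$, let $P,Q$ be the commuting linear operators $P(v)=x\cdot v$, $Q(v)=y\cdot v$ on $V$. The Lie algebra $L_V=\mathbb K\langle P,Q\rangle\rightthreetimes V$ associated with $V$ is the external semidirect product of the two-dimensional abelian Lie algebra with basis $P,Q$ (always two-dimensional, even if $P,Q$ are linearly dependent as operators) and the abelian Lie algebra $V$: as a vector space it is $\mathbb K\langle P,Q\rangle\oplus V$, with bracket $[P,Q]=0$, $[v,v']=0$, $[P,v]=P(v)$, $[Q,v]=Q(v)$ for $v,v'\in V$. $L_W$ is defined in the same way from $W$. Weak isomorphism: a linear automorphism $\theta$ of $\mathbb K[x,y]$ is a $\mathbb K$-algebra automorphism of the form $\theta(x)=\alpha_{11}x+\alpha_{12}y$, $\theta(y)=\alpha_{21}x+\alpha_{22}y$ with $[\alpha_{ij}]$ a nonsingular matrix over $\mathbb K$. The twisted module $V_\theta$ is the vector space $V$ with the action $x\circ v=\theta(x)\cdot v$, $y\circ v=\theta(y)\cdot v$. Modules $V$ and $W$ are weakly isomorphic if there is a finite sequence of $\mathbb K[x,y]$-modules $V_1=V,V_2,\dots,V_k=W$ such that for each $i=1,\dots,k-1$ either $V_i\simeq V_{i+1}$ or $V_{i+1}=(V_i)_{\theta_i}$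 for some linear automorphism $\theta_i$. *)

(* Defs.v *)
From HB Require Import structures.
From mathcomp Require Import all_boot all_order all_algebra.
From mathcomp Require Export mpoly.

Set Implicit Arguments.
Unset Strict Implicit.
Unset Printing Implicit Defensive.

Import GRing.Theory.
Local Open Scope ring_scope.

HB.mixin Record Lmodule_isLie (K : fieldType) L & GRing.Lmodule K L := {
  lie_bracket : L -> L -> L;
  lie_bracket_linearl : forall w, linear (lie_bracket^~ w);
  lie_bracket_linearr : forall u, linear (lie_bracket u);
  lie_bracket_alt : forall u, lie_bracket u u = 0;
  lie_jacobi : forall u v w,
    lie_bracket u (lie_bracket v w) + lie_bracket v (lie_bracket w u)
      + lie_bracket w (lie_bracket u v) = 0
}.

#[short(type="lieAlgType")]
HB.structure Definition LieAlgebra (K : fieldType) :=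
  { L of GRing.Lmodule K L & Lmodule_isLie K L }.

Definition lie_isomorphic (K : fieldType) (L1 L2 : lieAlgType K) : Prop :=
  exists f : {linear L1 -> L2},
    bijective f
    /\ forall u v, f (lie_bracket u v) = lie_bracket (f u) (f v).

(* K[x, y] is {mpoly K[2]}, with x = 'X_0 and y = 'X_1. A K[x, y]-module V is
   a vector space over K through the constant polynomials; Kspace V is V with
   this restricted structure. *)
Definition Kspace (K : fieldType) (V : lmodType {mpoly K[2]}) : Type := V.

Section RestrictionOfScalars.
Context (K : fieldType) (V : lmodType {mpoly K[2]}).

HB.instance Definition _ := GRing.Zmodule.on (Kspace V).

Let scaleK (c : K) (v : Kspace V) : Kspace V := c%:MP_[2] *: (v : V).

Let scaleKA a b v : scaleK a (scaleK b v) = scaleK (a * b) v.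
Proof. by rewrite /scaleK scalerA mpolyCM. Qed.

Let scaleK1 : left_id 1 scaleK.
Proof. by move=> v; rewrite /scaleK mpolyC1 scale1r. Qed.

Let scaleKDr : right_distributive scaleK +%R.
Proof. by move=> c u v; rewrite /scaleK; exact: scalerDr. Qed.

Let scaleKDl v : {morph scaleK^~ v : a b / a + b}.
Proof. by move=> a b; rewrite /scaleK mpolyCD; exact: scalerDl. Qed.

HB.instance Definition _ := GRing.Zmodule_isLmodule.Build K (Kspace V)
  scaleKA scaleK1 scaleKDr scaleKDl.

Lemma KspaceZE (c : K) (v : V) : c *: (v : Kspace V) = c%:MP_[2] *: v.
Proof. by []. Qed.

Definition opP (v : Kspace V) : Kspace V := ('X_0 : {mpoly K[2]}) *: (v : V).
Definition opQ (v : Kspace V) : Kspace V := ('X_1 : {mpoly K[2]}) *: (v : V).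

Fact opP_is_linear : linear opP.
Proof.
move=> c u v; rewrite /opP [LHS](@scalerDr _ V) (KspaceZE c ('X_0 *: (u : V))).
by rewrite KspaceZE !scalerA mulrC.
Qed.

Fact opQ_is_linear : linear opQ.
Proof.
move=> c u v; rewrite /opQ [LHS](@scalerDr _ V) (KspaceZE c ('X_1 *: (u : V))).
by rewrite KspaceZE !scalerA mulrC.
Qed.

HB.instance Definition _ :=
  GRing.isLinear.Build K (Kspace V) (Kspace V) *:%R opP opP_is_linear.
HB.instance Definition _ :=
  GRing.isLinear.Build K (Kspace V) (Kspace V) *:%R opQ opQ_is_linear.

Lemma opPQC v : opP (opQ v) = opQ (opP v).
Proof. by rewrite /opP /opQ !scalerA mulrC. Qed.

End RestrictionOfScalars.

Definition finite_dimensional (K : fieldType) (V : lmodType {mpoly K[2]}) :=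
  exists n, inhabited (Vector.axiom n (Kspace V)).

(* The triple (a, b, v) stands for a P + b Q + v; P and Q are formal basis
   elements here, independent even when the operators opP and opQ are not. *)
Definition assoc_lie (K : fieldType) (V : lmodType {mpoly K[2]}) : Type :=
  (K^o * K^o * Kspace V)%type.

Section AssociatedLieAlgebra.
Context (K : fieldType) (V : lmodType {mpoly K[2]}).

HB.instance Definition _ := GRing.Lmodule.on (assoc_lie V).

(* [a P + b Q + v, a' P + b' Q + v'] = (a P(v') + b Q(v')) - (a' P(v) + b' Q(v)),
   which is the bilinear alternating extension of [P, Q] = 0, [v, v'] = 0,
   [P, v] = P(v) and [Q, v] = Q(v). *)
Definition assoc_bracket (s t : assoc_lie V) : assoc_lie V :=
  let: (a, b, v) := s : K * K * Kspace V in
  let: (a', b', v') := t : K * K * Kspace V in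
  (0, 0, (a *: opP v' + b *: opQ v') - (a' *: opP v + b' *: opQ v)).

Fact assoc_bracket_anti s t : assoc_bracket s t = - assoc_bracket t s.
Proof.
case: s t => [[a b] v] [[a' b'] v'] /=.
by congr (_, _, _); rewrite ?oppr0 ?opprB.
Qed.

Let D (a b : K) (v : Kspace V) : Kspace V := a *: opP v + b *: opQ v.

Let D_linear a b : linear (D a b).
Proof.
move=> c u v; rewrite /D opP_is_linear opQ_is_linear !scalerDr !scalerA.
by rewrite [a * c]mulrC [b * c]mulrC addrACA.
Qed.

Let DD c a1 b1 a2 b2 v :
  D (c * a1 + a2) (c * b1 + b2) v = c *: D a1 b1 v + D a2 b2 v.
Proof. by rewrite /D !scalerDl scalerDr !scalerA addrACA. Qed.

Let D0 v : D 0 0 v = 0.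
Proof. by rewrite /D !scale0r addr0. Qed.

Let DB a b u v : D a b (u - v) = D a b u - D a b v.
Proof. by rewrite addrC -scaleN1r D_linear scaleN1r addrC. Qed.

Let DC a b a' b' v : D a b (D a' b' v) = D a' b' (D a b v).
Proof.
have DE c d x y : D c d (x + y) = D c d x + D c d y.
  by rewrite -[x]scale1r D_linear !scale1r.
have DZ c d k w : D c d (k *: w) = k *: D c d w.
  by rewrite -[k *: w]addr0 D_linear -(subrr (0 : Kspace V)) DB subrr addr0.
rewrite [D a' b' v]/D DE !DZ.
rewrite -[RHS]/(a' *: opP (D a b v) + b' *: opQ (D a b v)).
congr (_ *: _ + _ *: _); rewrite /D.
  by rewrite opP_is_linear [opP (b *: _)]linearZ /= opPQC.
by rewrite opQ_is_linear [opQ (b *: _)]linearZ /= opPQC.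
Qed.

Fact assoc_bracket_linearr s : linear (assoc_bracket s).
Proof.
case: s => [[a b] v] c [[a1 b1] v1] [[a2 b2] v2].
transitivity ((0, 0, D a b (c *: v1 + v2) - D (c * a1 + a2) (c * b1 + b2) v)
  : assoc_lie V); first by [].
transitivity ((c *: 0 + 0, c *: 0 + 0,
  c *: (D a b v1 - D a1 b1 v) + (D a b v2 - D a2 b2 v)) : assoc_lie V);
  last by [].
by rewrite D_linear DD scaler0 addr0 scalerBr opprD addrACA.
Qed.

Fact assoc_bracket_linearl t : linear (assoc_bracket^~ t).
Proof.
move=> c s1 s2; rewrite ![assoc_bracket _ t]assoc_bracket_anti.
by rewrite assoc_bracket_linearr opprD scalerN.
Qed.

Fact assoc_bracket_alt s : assoc_bracket s s = 0.
Proof. by case: s => [[a b] v] /=; rewrite subrr. Qed.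

Fact assoc_jacobi s t u :
  assoc_bracket s (assoc_bracket t u) + assoc_bracket t (assoc_bracket u s)
    + assoc_bracket u (assoc_bracket s t) = 0.
Proof.
case: s t u => [[a1 b1] v1] [[a2 b2] v2] [[a3 b3] v3].
transitivity ((0 + 0 + 0, 0 + 0 + 0,
  (D a1 b1 (D a2 b2 v3 - D a3 b3 v2) - D 0 0 v1)
  + (D a2 b2 (D a3 b3 v1 - D a1 b1 v3) - D 0 0 v2)
  + (D a3 b3 (D a1 b1 v2 - D a2 b2 v1) - D 0 0 v3)) : assoc_lie V); first by [].
rewrite !D0 !subr0 !addr0 !DB.
rewrite (DC a2 b2 a1 b1 v3) (DC a3 b3 a1 b1 v2) (DC a3 b3 a2 b2 v1).
congr (_, _, _); set x := D a1 b1 _; set y := D a1 b1 _; set z := D a2 b2 _.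
by rewrite [x - y + _]addrC subrKA subrKA subrr.
Qed.

HB.instance Definition _ := Lmodule_isLie.Build K (assoc_lie V)
  assoc_bracket_linearl assoc_bracket_linearr assoc_bracket_alt assoc_jacobi.

End AssociatedLieAlgebra.

Record linear_automorphism (K : fieldType) := LinearAutomorphism {
  linaut_map :> {lrmorphism {mpoly K[2]} -> {mpoly K[2]}};
  linaut_bij : bijective linaut_map;
  linaut_lin : exists2 A : 'M[K]_2, A \in unitmx &
    forall i, linaut_map 'X_i = \sum_(j < 2) A i j *: 'X_j
}.

(* Since theta is an algebra morphism, acting by theta x and theta y extends to
   letting each polynomial p act as theta p. *)
Definition twist (K : fieldType) (theta : linear_automorphism K)
  (V : lmodType {mpoly K[2]}) : Type := V.

Section Twist.
Context (K : fieldType) (theta : linear_automorphism K).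
Context (V : lmodType {mpoly K[2]}).

HB.instance Definition _ := GRing.Zmodule.on (twist theta V).

Let scaleT (p : {mpoly K[2]}) (v : twist theta V) : twist theta V :=
  theta p *: (v : V).

Let scaleTA p q v : scaleT p (scaleT q v) = scaleT (p * q) v.
Proof. by rewrite /scaleT scalerA rmorphM. Qed.

Let scaleT1 : left_id 1 scaleT.
Proof. by move=> v; rewrite /scaleT rmorph1 scale1r. Qed.

Let scaleTDr : right_distributive scaleT +%R.
Proof. by move=> p u v; rewrite /scaleT; exact: scalerDr. Qed.

Let scaleTDl v : {morph scaleT^~ v : p q / p + q}.
Proof. by move=> p q; rewrite /scaleT rmorphD; exact: scalerDl. Qed.

HB.instance Definition _ :=
  GRing.Zmodule_isLmodule.Build {mpoly K[2]} (twist theta V)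
    scaleTA scaleT1 scaleTDr scaleTDl.

Lemma twistZE (p : {mpoly K[2]}) (v : V) :
  p *: (v : twist theta V) = theta p *: v.
Proof. by []. Qed.

End Twist.

Definition module_isomorphic (K : fieldType) (V W : lmodType {mpoly K[2]}) :=
  exists f : {linear V -> W}, bijective f.

Definition weakly_isomorphic (K : fieldType) (V W : lmodType {mpoly K[2]}) :=
  exists (k : nat) (M : nat -> lmodType {mpoly K[2]}),
    [/\ M 0%N = V, M k = W &
        forall i, (i < k)%N ->
          module_isomorphic (M i) (M i.+1)
          \/ exists theta : linear_automorphism K,
               M i.+1 = (twist theta (M i) : lmodType {mpoly K[2]})].

(* Main.v *)
Require Import Defs.
From HB Require Import structures.
From mathcomp Require Import all_boot all_order all_algebra.

Set Implicit Arguments.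
Unset Strict Implicit.
Unset Printing Implicit Defensive.

Import GRing.Theory.
Local Open Scope ring_scope.

(** Isomorphism of Lie algebras is an equivalence relation, so it suffices to treat one link of the
    chain. A module isomorphism commutes with the operators P and Q, so extending it by the identity
    on the span of P and Q respects brackets ([module_isomorphic_assoc_lie]). A twist keeps the
    K-space V and replaces P, Q by invertible linear combinations of them, so the Lie algebra of the
    twist is that of V in another basis of the span of P and Q ([twist_assoc_lie]). *)

Section LieIsomorphic.
Context (K : fieldType).
Implicit Types L : lieAlgType K.

Lemma lie_isomorphicP L1 L2 (f : L1 -> L2) :
  linear f -> bijective f ->
  (forall u v, f (lie_bracket u v) = lie_bracket (f u) (f v)) ->
  lie_isomorphic L1 L2.
Proof.
move=> f_lin f_bij f_bracket.
pose fL := GRing.isLinear.Build K L1 L2 *:%R f f_lin.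
pose F : {linear L1 -> L2} := HB.pack f fL.
by exists F.
Qed.

Lemma lie_isomorphic_refl L : lie_isomorphic L L.
Proof. by apply: (@lie_isomorphicP _ _ id) => //; exists id. Qed.

Lemma lie_isomorphic_sym L1 L2 : lie_isomorphic L1 L2 -> lie_isomorphic L2 L1.
Proof.
case=> f [[g fK gK] f_bracket].
have f_inj : injective f := can_inj fK.
apply: (@lie_isomorphicP _ _ g).
- by move=> c u v; apply: f_inj; rewrite linearP !gK.
- by exists f.
- by move=> u v; apply: f_inj; rewrite f_bracket !gK.
Qed.

Lemma lie_isomorphic_trans L1 L2 L3 :
  lie_isomorphic L1 L2 -> lie_isomorphic L2 L3 -> lie_isomorphic L1 L3.
Proof.
case=> f [f_bij f_bracket] [g [g_bij g_bracket]].
apply: (@lie_isomorphicP _ _ (g \o f)).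
- by move=> c u v /=; rewrite !linearP.
- exact: bij_comp.
- by move=> u v /=; rewrite f_bracket g_bracket.
Qed.

End LieIsomorphic.

Section AssocLie.
Context (K : fieldType).
Implicit Types V W : lmodType {mpoly K[2]}.

Lemma module_isomorphic_assoc_lie V W :
  module_isomorphic V W -> lie_isomorphic (assoc_lie V) (assoc_lie W).
Proof.
case=> f [g fK gK].
pose F (s : assoc_lie V) : assoc_lie W := (s.1, f s.2).
(* Linearity over K[x, y], read at a constant, at x and at y, gives K-linearity and commutation with
   P and Q. *)
have fZ (c : K) (u : Kspace V) : f (c *: u) = c *: (f u : Kspace W).
  exact: linearZ.
have fP (u : Kspace V) : f (opP u) = opP (f u : Kspace W) by exact: linearZ.
have fQ (u : Kspace V) : f (opQ u) = opQ (f u : Kspace W) by exact: linearZ.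
have fD (u v : Kspace V) : f (u + v) = (f u : Kspace W) + f v by exact: raddfD.
have fB (u v : Kspace V) : f (u - v) = (f u : Kspace W) - f v by exact: raddfB.
apply: (@lie_isomorphicP _ _ _ F).
- by move=> c [s u] [t v]; rewrite /F /= fD fZ.
- exists (fun s => (s.1, g s.2)) => -[s u]; rewrite /F /=; first by rewrite fK.
  by rewrite gK.
- by move=> [[a b] u] [[a' b'] v]; rewrite /F /= fB !fD !fZ !fP !fQ.
Qed.

(* In the Lie algebra of the twist by theta, P acts on V as theta x, so it is
   sent to A 0 0 P + A 0 1 Q: A multiplies the row vector of P, Q coordinates
   on the right. *)
Definition change_basis V (A : 'M[K]_2) (s : K * K * V) : K * K * V :=
  (s.1.1 * A 0 0 + s.1.2 * A 1 0, s.1.1 * A 0 1 + s.1.2 * A 1 1, s.2).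

Lemma change_basisK V (A B : 'M[K]_2) :
  A *m B = 1%:M -> cancel (@change_basis V A) (@change_basis V B).
Proof.
move=> AB1 [[a b] v]; rewrite /change_basis /=.
have E i j : A i 0 * B 0 j + A i 1 * B 1 j = (i == j)%:R.
  move/matrixP/(_ i j): AB1; rewrite !mxE big_ord_recr big_ord1 /= => <-.
  (* The indices left by [big_ord_recr] agree with 0 and 1 only in value. *)
  by congr (A i _ * B _ j + A i _ * B _ j); apply: val_inj.
congr (_, _, _); rewrite !mulrDl addrACA -!mulrA -!mulrDr !E /=.
  by rewrite mulr1 mulr0 addr0.
by rewrite mulr1 mulr0 add0r.
Qed.

Lemma twist_assoc_lie (theta : linear_automorphism K) V :
  lie_isomorphic (assoc_lie (twist theta V)) (assoc_lie V).
Proof.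
have [A Au thetaX] := linaut_lin theta.
pose Vt : lmodType {mpoly K[2]} := twist theta V.
(* An algebra morphism fixes the constants, so the twist has the same K-space structure as [V]. *)
have KZ (c : K) (u : V) : c *: (u : Kspace Vt) = c *: (u : Kspace V).
  rewrite KspaceZE [LHS]twistZE KspaceZE -[c%:MP_[2]]mulr1 mul_mpolyC.
  by rewrite linearZ rmorph1.
have thetaE i (u : V) : theta 'X_i *: u =
    A i 0 *: opP (u : Kspace V) + A i 1 *: opQ (u : Kspace V).
  rewrite thetaX big_ord_recr big_ord1 /= [LHS]scalerDl -!mul_mpolyC -!scalerA.
  rewrite !KspaceZE.
  by congr ((A i _)%:MP *: ('X_ _ *: u) + (A i _)%:MP *: ('X_ _ *: u));
    apply: val_inj.
have opPt (u : V) : opP (u : Kspace Vt) =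
    A 0 0 *: opP (u : Kspace V) + A 0 1 *: opQ (u : Kspace V).
  exact: thetaE.
have opQt (u : V) : opQ (u : Kspace Vt) =
    A 1 0 *: opP (u : Kspace V) + A 1 1 *: opQ (u : Kspace V).
  exact: thetaE.
(* The action of a P + b Q on the twist is that of its image under [change_basis] on [V]. Since the
   V-part of a bracket is a difference of two such actions, this makes [F] preserve brackets. *)
have Dt (a b : K) (u : V) :
    a *: opP (u : Kspace Vt) + b *: opQ (u : Kspace Vt) =
    (a * A 0 0 + b * A 1 0) *: opP (u : Kspace V)
    + (a * A 0 1 + b * A 1 1) *: opQ (u : Kspace V).
  rewrite opPt opQt [X in X + _]KZ [X in _ + X]KZ !scalerDl -!scalerA.
  by rewrite addrACA -!scalerDr.
pose F : assoc_lie Vt -> assoc_lie V := @change_basis V A.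
apply: (@lie_isomorphicP _ _ _ F).
- move=> c [[a b] u] [[a' b'] u'].
  have coordE (x y : K) : (c * a + a') * x + (c * b + b') * y =
      c * (a * x + b * y) + (a' * x + b' * y).
    by rewrite !mulrDl mulrDr addrACA !mulrA.
  by congr (_, _, _); [exact: coordE | exact: coordE | congr (_ + _); exact: KZ].
(* As P and Q are formal basis elements, invertibility of [A] suffices even if the operators are
   dependent. *)
- by exists (@change_basis V (invmx A)); apply: change_basisK;
    rewrite (mulmxV, mulVmx).
- move=> [[a b] u] [[a' b'] u'].
  congr (_, _, _); try by rewrite /= !mul0r addr0.
  by congr (_ - _); exact: Dt.
Qed.

Lemma weakly_isomorphic_assoc_lie V W :
  weakly_isomorphic V W -> lie_isomorphic (assoc_lie V) (assoc_lie W).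
Proof.
case=> k [M [<- <- step]].
elim: k step => [|k IHk] step; first exact: lie_isomorphic_refl.
apply: lie_isomorphic_trans (IHk _) _ => [i lt_ik|]; first exact/step/ltnW.
have [//|isoM|[theta ->]] := step k; first exact: module_isomorphic_assoc_lie.
(* The chain passes from a module to its twist, against the direction of [twist_assoc_lie]. *)
exact/lie_isomorphic_sym/twist_assoc_lie.
Qed.

End AssocLie.

Theorem proposition1 (K : closedFieldType) (pcharK0 : [pchar K]%R =i pred0)
    (V W : lmodType {mpoly K[2]})
    (finV : finite_dimensional V) (finW : finite_dimensional W) :
  weakly_isomorphic V W -> lie_isomorphic (assoc_lie V) (assoc_lie W).
Proof. exact: weakly_isomorphic_assoc_lie. Qed.
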